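(* The function $\tau:\mathbb{R}\setminus\mathbb{Q}\to[1,\infty]$ is surjective. Moreover, for any given $t\in[1,\infty]$, the set $\{\alpha\in\mathbb{R}\setminus\mathbb{Q}:\tau(\alpha)=t\}$ is dense in the space $\mathbb{R}\setminus\mathbb{Q}$.
   Context: For real $x$, $\|x\|:=\min_{n\in\mathbb{Z}}|x-n|$ denotes the distance from $x$ to the nearest integer. For an irrational real number $\alpha$, the type of $\alpha$ is $$\tau(\alpha):=\sup\big\{\theta\in\mathbb{R}:\liminf_{q\to\infty,\ q\in\mathbb{N}} q^\theta\|q\alpha\|=0\big\}\in[1,\infty].$$ The space $\mathbb{R}\setminus\mathbb{Q}$ carries the topology inherited from $\mathbb{R}$. *)

(* Defs.v *)
From HB Require Import structures.
From mathcomp Require Import all_boot all_order all_algebra.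
From mathcomp Require Import all_classical all_reals all_analysis.

Set Implicit Arguments.
Unset Strict Implicit.
Unset Printing Implicit Defensive.

Import Order.TTheory GRing.Theory Num.Theory.
Import numFieldNormedType.Exports.

Local Open Scope classical_set_scope.
Local Open Scope ring_scope.

(* Distance to the nearest integer; the infimum is attained, see
   [dist_int_min]. *)
Definition dist_int (R : realType) (x : R) : R :=
  inf [set `|x - n%:~R| | n in [set: int]].

Lemma dist_int_min (R : realType) (x : R) :
  (exists n : int, dist_int x = `|x - n%:~R|) /\
  (forall n : int, dist_int x <= `|x - n%:~R|).
Proof.
set S := [set `|x - n%:~R| | n in [set: int]].
have lbS : has_lbound S by exists 0 => _ [n _ <-]; exact: normr_ge0.
have lb n : dist_int x <= `|x - n%:~R| by apply: ge_inf => //; exists n.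
split=> //; pose k := Num.floor x.
have kx : k%:~R <= x by rewrite floor_le_tmp.
have xk : x < (k + 1)%:~R by rewrite floorD1_gt.
pose m := Num.min `|x - k%:~R| `|x - (k + 1)%:~R|.
have mS : m <= dist_int x.
  apply: lb_le_inf; first by exists `|x - k%:~R|; exists k.
  move=> _ [n _ <-]; rewrite ge_min; have [nk|kn] := leP n k.
    have nkR : n%:~R <= k%:~R :> R by rewrite ler_int.
    apply/orP; left; rewrite !ger0_norm ?subr_ge0//; last exact: le_trans kx.
    by rewrite lerD2l lerN2.
  have knR : (k + 1)%:~R <= n%:~R :> R by rewrite ler_int lezD1.
  apply/orP; right; rewrite !ler0_norm ?subr_le0 ?(ltW xk)//.
    by rewrite lerN2 lerD2l lerN2.
  exact: le_trans (ltW xk) knR.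
move: mS; rewrite /m minEle; case: ifP => _ mS.
  by exists k; apply/eqP; rewrite eq_le lb mS.
by exists (k + 1); apply/eqP; rewrite eq_le lb mS.
Qed.

(* The carrier is the subtype of irrational reals, which the library equips
   with the topology induced by the inclusion into R. *)
Definition irr_type (R : realType) (alpha : @irrational R) : \bar R :=
  ereal_sup [set theta%:E | theta in
    [set theta : R | limn_einf
       (fun q : nat => (q%:R `^ theta * dist_int (q%:R * \val alpha))%:E)
       = 0%E]].

(* Main.v *)
Require Import Defs.
From HB Require Import structures.
From mathcomp Require Import all_boot all_order all_algebra.
From mathcomp Require Import all_classical all_reals all_analysis.
From mathcomp Require Import ring lra zify.

Import Order.TTheory GRing.Theory Num.Theory.
Import numFieldNormedType.Exports.

Local Open Scope classical_set_scope.
Local Open Scope ring_scope.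

Set Implicit Arguments.
Unset Strict Implicit.
Unset Printing Implicit Defensive.

(** The set of exponents [theta] with [liminf q^theta ||q x|| = 0] consists of
    those for which [q^theta ||q x||] takes arbitrarily small values at
    arbitrarily large [q] ([limn_einf_eq0]); call these approximable.

    By the pigeonhole principle some [q <= N] satisfies [||q x|| < 1/N], and
    for irrational [x] such [q] are unbounded as [N] grows, so every
    [theta < 1] is approximable and the type is at least 1
    ([approximable_lt1]).

    To realize a given [t], build an irrational number from its continued
    fraction.  Choosing the partial quotient [a_n] close to [q_{n+1}^{s_n}], where
    [q_{n+1}] is the denominator reached so far, makes the denominators grow
    like [q_{n+2} ~ q_{n+1}^{1 + s_n}] ([digit_growth]).  The error
    [|q_n x - p_n|] is [1/q_{n+1}] up to a factor 2 ([gap_ub], [gap_lb]), and no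
    [k] with [0 < k < q_{n+1}] does better ([best_approximation]).  Hence
    [q_{n+1}^theta ||q_{n+1} x||] tends to 0 when [1 + s_n] eventually exceeds [theta] by a fixed amount
    ([approximable_digit]), whereas [k^theta ||k x||] stays above 1/6 when
    [1 + s_n <= theta] for all [n] ([not_approximable_digit]).  Taking
    [s_n = t - 1] for finite [t], and [s_n = n] for [t = +oo], yields type [t].

    Density comes for free: multiplying [q] by the denominator of a rational
    [r] shows that translation by [r] preserves approximable exponents, so
    the translates by rationals of a single number of type [t] all have
    type [t] ([irr_typeD_rat]), and they are dense. *)

(** * Approximable exponents and the type *)

Definition approximable (R : realType) (x theta : R) :=
  forall (eps : R) (N : nat), 0 < eps ->
  exists2 q : nat, (N <= q)%N & q%:R `^ theta * dist_int (q%:R * x) < eps.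

Lemma dist_int_ge0 (R : realType) (x : R) : 0 <= dist_int x.
Proof. by have [[n ->] _] := dist_int_min x; exact: normr_ge0. Qed.

Lemma limn_einf_eq0 (R : realType) (u : nat -> R) : (forall n, 0 <= u n) ->
  limn_einf (EFin \o u) = 0%E <->
  forall (eps : R) (N : nat), 0 < eps -> exists2 n : nat, (N <= n)%N & u n < eps.
Proof.
move=> u0.
have -> : limn_einf (EFin \o u) = ereal_sup (range (einfs (EFin \o u))).
  by rewrite limn_einf_lim; apply: cvg_lim => //; exact: cvg_einfs_sup.
split=> [sup0 eps N eps0|small].
  have : (einfs (EFin \o u) N < eps%:E)%E.
    apply: (@le_lt_trans _ _ 0%E); last by rewrite lte_fin.
    by rewrite -sup0; apply: ereal_sup_ubound; exists N.
  by move=> /ereal_inf_ltP[_ [n /= Nn <-]]; rewrite lte_fin; exists n.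
apply/eqP; rewrite eq_le; apply/andP; split.
  apply: ge_ereal_sup => _ [N _ <-]; apply/lee_addgt0Pr => eps eps0.
  rewrite add0e; have [n Nn /ltW un] := small eps N eps0.
  apply: (@le_trans _ _ (u n)%:E); last by rewrite lee_fin.
  by apply: ereal_inf_lbound; exists n.
apply: (@le_trans _ _ (einfs (EFin \o u) 0%N)).
  by apply/ereal_infP => _ [n _ <-]; rewrite lee_fin.
by apply: ereal_sup_ubound; exists 0%N.
Qed.

Lemma irr_typeE (R : realType) (x : @irrational R) :
  irr_type x = ereal_sup [set theta%:E | theta in approximable (\val x)].
Proof.
congr (ereal_sup (image _ _)); apply/seteqP.
by split=> theta /=; rewrite (limn_einf_eq0 (u := fun q => _)) // => q;
  rewrite mulr_ge0 ?powR_ge0 ?dist_int_ge0.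
Qed.

(** The bound need only be tested at real exponents because [t] may be
    infinite: a gap between the supremum and [t] always contains a real. *)
Lemma irr_type_ge (R : realType) (x : @irrational R) (t : \bar R) :
  (forall theta, (theta%:E < t)%E -> approximable (\val x) theta) ->
  (t <= irr_type x)%E.
Proof.
move=> app; rewrite irr_typeE leNgt; apply/negP => supt.
have [theta th1 th2] : exists2 theta : R,
    (ereal_sup [set theta%:E | theta in approximable (\val x)] < theta%:E)%E &
    (theta%:E < t)%E.
  move: supt; case: (ereal_sup _) => [s||] //; case: t {app} => [t||] //.
  - rewrite lte_fin => st; exists ((s + t) / 2); rewrite lte_fin; lra.
  - by exists (s + 1); rewrite ?ltry// lte_fin ltrDl.
  - by exists (t - 1); rewrite ?ltNyr// lte_fin gtrBl.
  - by exists 0; rewrite ?ltNyr ?ltry.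
move/lt_geF: th1 => /negP; apply; apply: ereal_sup_ubound.
by exists theta => //; apply: app.
Qed.

Lemma irr_type_le (R : realType) (x : @irrational R) (t : \bar R) :
  (forall theta, (t < theta%:E)%E -> ~ approximable (\val x) theta) ->
  (irr_type x <= t)%E.
Proof.
move=> napp; rewrite irr_typeE; apply: ge_ereal_sup => _ [theta app <-].
by rewrite leNgt; apply/negP => /napp.
Qed.

(** * Dirichlet's theorem *)

Lemma powRN_small (R : realType) (c eps : R) : 0 < c -> 0 < eps ->
  exists M : nat, forall n : nat, (M <= n)%N -> n%:R `^ (- c) < eps.
Proof.
move=> c0 eps0; exists (Num.truncn (eps^-1 `^ c^-1)).+1 => n Mn.
have yn : eps^-1 `^ c^-1 < n%:R.
  by apply: lt_le_trans (truncnS_gt _) _; rewrite ler_nat.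
rewrite powRN invf_plt ?posrE ?powR_gt0//; last first.
  by apply: le_lt_trans yn; exact: powR_ge0.
have -> : eps^-1 = (eps^-1 `^ c^-1) `^ c.
  by rewrite -powRrM mulVf ?gt_eqF// powRr1// invr_ge0 ltW.
by apply: gt0_ltr_powR => //; rewrite nnegrE ?powR_ge0.
Qed.

(** Among the [N + 1] fractional parts of [0 x, ..., N x], two lie in the same
    interval of length [1/N]; the difference of their indices is [q]. *)
Lemma dirichlet (R : realType) (x : R) (N : nat) : (0 < N)%N ->
  exists2 q : nat, (0 < q <= N)%N & dist_int (q%:R * x) < N%:R^-1.
Proof.
move=> N0; have N0R : 0 < N%:R :> R by rewrite ltr0n.
pose fr (i : nat) : R := i%:R * x - (Num.floor (i%:R * x))%:~R.
have fr0 i : 0 <= fr i by rewrite subr_ge0; case/andP: (floor_itv (i%:R * x)).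
have fr1 i : fr i < 1.
  by rewrite ltrBlDl -intrD1; case/andP: (floor_itv (i%:R * x)).
have box_lt i : (Num.truncn (N%:R * fr i) < N)%N.
  rewrite truncn_lt_nat; last by rewrite mulr_ge0.
  by rewrite -[ltRHS]mulr1 ltr_pM2l.
pose box (i : 'I_N.+1) : 'I_N := Ordinal (box_lt i).
have /injectivePn[i [j ij]] : ~~ injectiveb box.
  apply/negP => /injectiveP/leq_card.
  by rewrite !card_ord ltnn.
wlog ltij : i j ij / (i < j)%N.
  move=> H E; have : (i != j :> nat) by exact: ij.
  rewrite neq_ltn => /orP[h|h]; first exact: (H i j).
  by apply: (H j i) => //; rewrite eq_sym.
move=> /(congr1 val) /= E.
exists (j - i)%N; first by have := ltn_ord j; lia.
have [_ /(_ (Num.floor (j%:R * x) - Num.floor (i%:R * x)))] :=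
  dist_int_min ((j - i)%N%:R * x).
move=> /le_lt_trans; apply.
have -> : (j - i)%N%:R * x - (Num.floor (j%:R * x) - Num.floor (i%:R * x))%:~R
   = fr j - fr i.
  by rewrite natrB ?(ltnW ltij)// intrB /fr; ring.
have /andP[i1 i2] := truncn_itv (mulr_ge0 (ltW N0R) (fr0 i)).
have /andP[j1 j2] := truncn_itv (mulr_ge0 (ltW N0R) (fr0 j)).
rewrite -[ltRHS]mul1r ltr_pdivlMr// -[X in _ * X]ger0_norm ?ler0n// -normrM.
rewrite ltr_norml; move: i1 i2 j1 j2; rewrite -E -natr1.
set T := (Num.truncn _)%:R; move=> i1 i2 j1 j2.
by apply/andP; split; lra.
Qed.

Lemma dist_int_gt0 (R : realType) (x : R) (q : nat) : irrational x -> (0 < q)%N ->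
  0 < dist_int (q%:R * x).
Proof.
move=> irr q0; rewrite lt_def dist_int_ge0 andbT; apply/eqP => E.
have [[n nE] _] := dist_int_min (q%:R * x).
apply: irr; exists (n%:~R / q%:R) => //.
rewrite fmorph_div /= ratr_int ratr_nat; apply/esym.
have : q%:R * x = n%:~R by apply/eqP; rewrite -subr_eq0 -normr_eq0 -nE E.
by move=> <-; rewrite mulrC mulKf// pnatr_eq0 -lt0n.
Qed.

(** The distances [||q x||] with [0 < q < N] are bounded below by some [d > 0],
    as [x] is irrational; a Dirichlet denominator at precision finer than [d]
    is therefore at least [N], and [q^theta ||q x|| <= q^(theta - 1)]. *)
Lemma approximable_lt1 (R : realType) (x theta : R) :
  irrational x -> theta < 1 -> approximable x theta.
Proof.
move=> irr th1 eps N eps0.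
have [M Mlt] : exists M : nat, forall n : nat, (M <= n)%N ->
    n%:R `^ (- (1 - theta)) < eps by apply: powRN_small; rewrite ?subr_gt0.
have [d d0 dle] : exists2 d : R, 0 < d &
    forall q, (0 < q < maxn M N)%N -> d <= dist_int (q%:R * x).
  elim: (maxn M N) => [|K [d d0 IH]].
    by exists 1 => // q; rewrite ltn0 andbF.
  have [->|K0] := posnP K; first by exists 1 => // q; lia.
  exists (Num.min d (dist_int (K%:R * x))).
    by rewrite lt_min d0 dist_int_gt0.
  move=> q /andP[q0]; rewrite ltnS leq_eqVlt ge_min => /orP[/eqP->|qK].
    by rewrite lexx orbT.
  by rewrite IH ?q0.
pose P := (Num.truncn d^-1).+1.
have [q /andP[q0 qP] qlt] := dirichlet x (ltn0Sn (Num.truncn d^-1)).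
have Pd : P%:R^-1 < d.
  by rewrite invf_plt ?posrE ?ltr0n// truncnS_gt.
have qMN : (maxn M N <= q)%N.
  rewrite leqNgt; apply/negP => qlt'.
  have : d <= dist_int (q%:R * x) by apply: dle; rewrite q0.
  by rewrite leNgt (lt_trans qlt).
exists q; first by move: qMN; rewrite geq_max => /andP[].
have qM : (M <= q)%N by move: qMN; rewrite geq_max => /andP[].
apply: le_lt_trans (Mlt q qM).
have q0R : 0 < q%:R :> R by rewrite ltr0n.
have -> : - (1 - theta) = theta - 1 by ring.
rewrite powRB; last by apply/implyP => _; rewrite gt_eqF.
rewrite powRr1// ler_pM2l ?powR_gt0//.
by apply: le_trans (ltW qlt) _; rewrite lef_pV2 ?posrE ?ltr0n// ler_nat.
Qed.

(** * Translation by rational numbers *)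

Lemma dist_intMn (R : realType) (x : R) (b : nat) (z : int) :
  dist_int (b%:R * x + z%:~R) <= b%:R * dist_int x.
Proof.
have [[n ->] _] := dist_int_min x.
have [_ /(_ (b%:Z * n + z)) /le_trans] := dist_int_min (b%:R * x + z%:~R); apply.
rewrite -[X in _ <= X * _]ger0_norm ?ler0n// -normrM rmorphD rmorphM /=.
by rewrite le_eqVlt; apply/orP; left; apply/eqP; congr (`|_|); ring.
Qed.

(** If [q] is good for [x] and [b] is the denominator of [r], then [b q] is good
    for [x + r], with a loss of the constant factor [b^theta * b]. *)
Lemma approximableD_rat (R : realType) (x theta : R) (r : rat) :
  approximable x theta -> approximable (x + ratr r) theta.
Proof.
move=> app eps N eps0.
pose b := `|denq r|%N.
have b0 : (0 < b)%N by rewrite absz_gt0 denq_eq0.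
have b0R : 0 < b%:R :> R by rewrite ltr0n.
have rE : b%:R * ratr r = (numq r)%:~R :> R.
  rewrite -{1}(divq_num_den r) fmorph_div /= !ratr_int mulrC.
  have -> : (denq r)%:~R = b%:R :> R by rewrite -[in LHS]absz_denq.
  by rewrite divfK// gt_eqF.
have [q Nq qlt] := app (eps / (b%:R `^ theta * b%:R)) N
  (divr_gt0 eps0 (mulr_gt0 (powR_gt0 _ b0R) b0R)).
exists (b * q)%N; first exact: leq_trans Nq (leq_pmull _ b0).
move: qlt; rewrite ltr_pdivlMr ?mulr_gt0 ?powR_gt0//; apply: le_lt_trans.
rewrite natrM powRM ?ler0n//.
have -> : b%:R * q%:R * (x + ratr r) = b%:R * (q%:R * x) + (q%:Z * numq r)%:~R.
  by rewrite rmorphM /= -rE; ring.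
have -> : q%:R `^ theta * dist_int (q%:R * x) * (b%:R `^ theta * b%:R) =
  b%:R `^ theta * q%:R `^ theta * (b%:R * dist_int (q%:R * x)) by ring.
by rewrite ler_wpM2l ?mulr_ge0 ?powR_ge0// dist_intMn.
Qed.

Lemma irrationalD_rat (R : realType) (x : R) (r : rat) :
  irrational x -> irrational (x + ratr r).
Proof.
move=> irr [s _ sE]; apply: irr; exists (s - r) => //.
by rewrite rmorphB /= sE addrK.
Qed.

(** The exponents for [x] transfer to [x + r], and back by translating by [- r]. *)
Lemma irr_typeD_rat (R : realType) (x y : @irrational R) (r : rat) :
  \val y = \val x + ratr r -> irr_type y = irr_type x.
Proof.
move=> yE; rewrite !irr_typeE; congr (ereal_sup (image _ _)); apply/seteqP.
split=> theta; last by rewrite yE; exact: approximableD_rat.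
move=> /(@approximableD_rat _ _ _ (- r)).
by rewrite yE rmorphN /= addrK.
Qed.

(** * Convergents of a continued fraction *)

(** The indexing starts at [0/1] and [1/1] rather than at the usual [1/0], so
    that all denominators are positive and the quotients [p n / q n] make
    sense from the start. *)
Record convergents (a p q : nat -> nat) : Prop := Convergents {
  partial_gt0 : forall n, (0 < a n)%N;
  num0 : p 0 = 0%N;
  num1 : p 1 = 1%N;
  numSS : forall n, p n.+2 = (a n * p n.+1 + p n)%N;
  den0 : q 0 = 1%N;
  den1 : q 1 = 1%N;
  denSS : forall n, q n.+2 = (a n * q n.+1 + q n)%N
}.

(** The partial quotient may depend on the denominator reached so far, which is
    what allows the growth of the denominators to be prescribed. *)
Lemma convergents_exist (a : nat -> nat -> nat) :
  (forall n x, (0 < a n x)%N) ->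
  exists p q, convergents (fun n => a n (q n.+1)) p q.
Proof.
move=> a0.
pose step n (s : (nat * nat) * (nat * nat)) :=
  let k := a n s.2.2 in
  (s.2, ((k * s.2.1 + s.1.1)%N, (k * s.2.2 + s.1.2)%N)).
pose st := fix st n := if n is m.+1 then step m (st m) else ((0, 1), (1, 1))%N.
by exists (fun n => (st n).1.1), (fun n => (st n).1.2); split.
Qed.

Lemma den_gt0 a p q : convergents a p q -> forall n, (0 < q n)%N.
Proof.
move=> C n; suff /andP[] : (0 < q n)%N && (0 < q n.+1)%N by [].
elim: n => [|n /andP[h1 h2]]; first by rewrite (den0 C) (den1 C).
by rewrite h2 (denSS C) addn_gt0 h1 orbT.
Qed.

Lemma den_ltS a p q : convergents a p q -> forall n, (q n.+1 < q n.+2)%N.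
Proof.
move=> C n; rewrite (denSS C).
have := den_gt0 C n; have := den_gt0 C n.+1; have := partial_gt0 C n; nia.
Qed.

Lemma den_ge a p q : convergents a p q -> forall n, (n <= q n)%N.
Proof.
move=> C; elim=> // -[|n] IH; first by rewrite (den1 C).
exact: leq_ltn_trans IH (den_ltS C n).
Qed.

Lemma convergents_det (A : comRingType) a p q : convergents a p q -> forall n,
  (q n)%:R * (p n.+1)%:R - (p n)%:R * (q n.+1)%:R = (-1) ^+ n :> A.
Proof.
move=> C; elim=> [|n IH]; first by
  rewrite (num0 C) (num1 C) (den0 C) (den1 C) /=; ring.
by rewrite exprS -IH (numSS C) (denSS C) !natrD !natrM; ring.
Qed.

(** For fixed [n] this expression satisfies, as a function of [k], the
    recurrence of the convergents, whose coefficients are nonnegative, and it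
    starts from 0 and 1; so even convergents lie below, and odd ones above, all later ones. *)
Lemma convergents_sided (A : realFieldType) a p q : convergents a p q ->
  forall n k, 0 <= (-1) ^+ n * ((q n)%:R * (p (n + k)%N)%:R -
                                (p n)%:R * (q (n + k)%N)%:R) :> A.
Proof.
move=> C n; pose D k : A := (-1) ^+ n * ((q n)%:R * (p (n + k)%N)%:R -
                                (p n)%:R * (q (n + k)%N)%:R).
rewrite -/(D _) => k; suff /andP[] : (0 <= D k) && (0 <= D k.+1) by [].
have sgn : (-1) ^+ n * (-1) ^+ n = 1 :> A.
  by rewrite -expr2 sqrr_sign.
elim: k => [|k /andP[h1 h2]].
  have -> : D 0%N = 0 by rewrite /D addn0; ring.
  have -> : D 1%N = 1 by rewrite /D addn1 (convergents_det _ C).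
  by rewrite lexx ler01.
rewrite h2 /=.
have -> : D k.+2 = (a (n + k)%N)%:R * D k.+1 + D k.
  by rewrite /D !addnS (numSS C) (denSS C) !natrD !natrM; ring.
by rewrite addr_ge0// mulr_ge0.
Qed.

(** The factor [(-1) ^ n] makes this equal to [|q_n x - p_n|] for the number [x]
    represented by the continued fraction. *)
Definition gap (R : realType) (p q : nat -> nat) (x : R) n : R :=
  (-1) ^+ n * ((q n)%:R * x - (p n)%:R).

(** The number sought is the supremum of the even convergents, every odd
    convergent being an upper bound of them.  Nonnegativity of all gaps says
    that it lies between any two consecutive convergents. *)
Lemma convergents_limit (R : realType) a p q : convergents a p q ->
  exists x : R, forall n, 0 <= gap p q x n.
Proof.
move=> C; pose e n : R := (p n)%:R / (q n)%:R.
have q0 n : 0 < (q n)%:R :> R by rewrite ltr0n (den_gt0 C).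
have e_le n k : ~~ odd n -> e n <= e (n + k)%N.
  move=> ev; have := convergents_sided R C n k.
  rewrite -signr_odd (negbTE ev) expr0 mul1r subr_ge0 /e => h.
  by rewrite ler_pdivrMr// mulrAC ler_pdivlMr// [leRHS]mulrC.
have e_ge n k : odd n -> e (n + k)%N <= e n.
  move=> od; have := convergents_sided R C n k.
  rewrite -signr_odd od expr1 mulN1r oppr_ge0 subr_le0 /e => h.
  by rewrite ler_pdivrMr// mulrAC ler_pdivlMr// [leLHS]mulrC.
pose S := [set e n | n in [set n | ~~ odd n]].
have ubS n : odd n -> ubound S (e n).
  move=> od _ [m /= ev <-]; have [mn|/ltnW nm] := leqP m n.
    by rewrite -(subnKC mn) e_le.
  by rewrite -(subnKC nm) e_ge.
have S0 : S !=set0 by exists (e 0%N), 0%N.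
exists (sup S) => n; rewrite /gap -signr_odd.
have -> : (q n)%:R * sup S - (p n)%:R = (q n)%:R * (sup S - e n).
  by rewrite mulrBr /e mulrCA mulfV ?gt_eqF// mulr1.
case: (boolP (odd n)) => od.
  rewrite expr1 mulN1r oppr_ge0 pmulr_rle0// subr_le0.
  by apply: ge_sup => //; apply: ubS.
rewrite expr0 mul1r pmulr_rge0// subr_ge0.
apply: ub_le_sup; last by exists n.
by exists (e 1%N); apply: ubS.
Qed.

Lemma gap_telescope (R : realType) a p q (x : R) : convergents a p q ->
  forall n, (q n.+1)%:R * gap p q x n + (q n)%:R * gap p q x n.+1 = 1.
Proof.
move=> C n.
have sgn : (-1) ^+ n * (-1) ^+ n = 1 :> R.
  by rewrite -expr2 sqrr_sign.
transitivity ((-1) ^+ n *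
    ((q n)%:R * (p n.+1)%:R - (p n)%:R * (q n.+1)%:R) : R).
  by rewrite /gap exprS; ring.
by rewrite (convergents_det _ C).
Qed.

Lemma gap_rec (R : realType) a p q (x : R) : convergents a p q ->
  forall n, gap p q x n = (a n)%:R * gap p q x n.+1 + gap p q x n.+2.
Proof.
by move=> C n; rewrite /gap !exprS (numSS C) (denSS C) !natrD !natrM; ring.
Qed.

Lemma gapS_le (R : realType) a p q (x : R) : convergents a p q ->
  (forall n, 0 <= gap p q x n) -> forall n, gap p q x n.+1 <= gap p q x n.
Proof.
move=> C g0 n; rewrite [leRHS](gap_rec x C).
have : 1 <= (a n)%:R :> R by rewrite ler1n (partial_gt0 C).
by have := g0 n.+1; have := g0 n.+2; nra.
Qed.

(** The other term of [gap_telescope] is nonnegative. *)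
Lemma gap_ub (R : realType) a p q (x : R) : convergents a p q ->
  (forall n, 0 <= gap p q x n) -> forall n, gap p q x n <= (q n.+1)%:R^-1.
Proof.
move=> C g0 n; have q0 m : 0 < (q m)%:R :> R by rewrite ltr0n (den_gt0 C).
rewrite -[leRHS]mul1r ler_pdivlMr// -[leRHS](gap_telescope x C n) mulrC lerDl.
by rewrite mulr_ge0// ltW.
Qed.

(** Both terms of [gap_telescope] are controlled by the larger gap. *)
Lemma gap_lb (R : realType) a p q (x : R) : convergents a p q ->
  (forall n, 0 <= gap p q x n) ->
  forall n, (2 * (q n.+2)%:R)^-1 <= gap p q x n.+1.
Proof.
move=> C g0 n; have q0 m : 0 < (q m)%:R :> R by rewrite ltr0n (den_gt0 C).
rewrite -[leLHS]mul1r ler_pdivrMr ?mulr_gt0// -[leLHS](gap_telescope x C n.+1).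
have := gapS_le C g0 n.+1; have := g0 n.+1; have := q0 n.+1.
have : (q n.+1)%:R <= (q n.+2)%:R :> R by rewrite ler_nat ltnW// (den_ltS C).
by nra.
Qed.

(** In the basis of two consecutive convergents, [(k, m)] has integer
    coordinates.  Since [0 < k < q_{n+1}], the first is nonzero and the second
    does not have the same sign; as the two errors [q_n x - p_n] also alternate
    in sign, their contributions to [k x - m] add up in absolute value. *)
Lemma best_approximation (R : realType) a p q (x : R) : convergents a p q ->
  (forall n, 0 <= gap p q x n) ->
  forall n (k : nat) (m : int), (0 < k < q n.+1)%N ->
  gap p q x n <= `|k%:R * x - m%:~R|.
Proof.
move=> C g0 n k m /andP[k0 kq].
pose e : int := (-1) ^+ n.
have det : e * ((q n)%:R * (p n.+1)%:R - (p n)%:R * (q n.+1)%:R) = 1.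
  by rewrite (convergents_det _ C) -expr2 sqrr_sign.
(* [A] and [B] are given by Cramer's rule for
   [(k, m) = A (q_n, p_n) + B (q_{n+1}, p_{n+1})]; multiplying by [e] replaces the division by the determinant. *)
pose A : int := e * (k%:R * (p n.+1)%:R - m * (q n.+1)%:R).
pose B : int := e * (m * (q n)%:R - k%:R * (p n)%:R).
have kE : A * (q n)%:R + B * (q n.+1)%:R = k%:R.
  by rewrite -[RHS]mulr1 -[X in _ = _ * X]det /A /B; ring.
have mE : A * (p n)%:R + B * (p n.+1)%:R = m.
  by rewrite -[RHS]mulr1 -[X in _ = _ * X]det /A /B; ring.
have xE : k%:R * x - m%:~R =
    (-1) ^+ n * (A%:~R * gap p q x n - B%:~R * gap p q x n.+1).
  have sgnR : (-1) ^+ n * (-1) ^+ n = 1 :> R.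
    by rewrite -expr2 sqrr_sign.
  transitivity ((-1) ^+ n * (-1) ^+ n * (k%:R * x - m%:~R)).
    by rewrite sgnR mul1r.
  have -> : k%:R = A%:~R * (q n)%:R + B%:~R * (q n.+1)%:R :> R.
    by rewrite -!(rmorph_nat (intr : int -> R)) -!rmorphM -rmorphD kE.
  have -> : m%:~R = A%:~R * (p n)%:R + B%:~R * (p n.+1)%:R :> R.
    by rewrite -!(rmorph_nat (intr : int -> R)) -!rmorphM -rmorphD mE.
  by rewrite /gap exprS; ring.
rewrite xE normrM normrX normrN1 expr1n mul1r.
have q0 m' : (0 < (q m')%:R :> int) by rewrite ltr0n (den_gt0 C).
have k0' : 0 < k%:R :> int by rewrite ltr0n.
have kq' : k%:R < (q n.+1)%:R :> int by rewrite ltr_nat.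
have := q0 n; have := q0 n.+1; have := g0 n; have := g0 n.+1.
set d := gap p q x n; set d' := gap p q x n.+1 => d'0 d0 q'0 qn0.
clearbody A B d d'; clear xE mE.
have [A0|A0|A0] := ltrgtP A 0.
- have B0 : 0 < B by nia.
  have : A%:~R <= -1 :> R by rewrite (ler_int R A (-1)); lia.
  have : 0 <= B%:~R :> R by rewrite ler0z ltW.
  by move=> hB hA; rewrite ler0_norm; nra.
- have B0 : B <= 0 by nia.
  have : 1 <= A%:~R :> R by rewrite (ler_int R 1 A); lia.
  have : B%:~R <= 0 :> R by rewrite lerz0.
  move=> hB hA; have hAd : d <= A%:~R * d by rewrite ler_peMl.
  have hBd : B%:~R * d' <= 0 by rewrite mulr_le0_ge0.
  by rewrite ger0_norm; lra.
- move: kE; rewrite A0 mul0r add0r => kE.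
  have [B0|B0] : B <= 0 \/ 1 <= B by lia.
    by nia.
  by nia.
Qed.


Lemma gap_gt0 (R : realType) a p q (x : R) : convergents a p q ->
  (forall n, 0 <= gap p q x n) -> forall n, 0 < gap p q x n.+1.
Proof.
move=> C g0 n; apply: lt_le_trans (gap_lb C g0 n).
by rewrite invr_gt0 mulr_gt0// ltr0n (den_gt0 C).
Qed.

(** If [x] had denominator [b], then [|b x - m|] would vanish for some integer
    [m], against [best_approximation] at an index with [b < q_{n+1}]. *)
Lemma gap_irrational (R : realType) a p q (x : R) : convergents a p q ->
  (forall n, 0 <= gap p q x n) -> irrational x.
Proof.
move=> C g0 [r _ rx]; pose b := `|denq r|%N.
have b0 : (0 < b)%N by rewrite absz_gt0 denq_eq0.
have : 0 < `|b%:R * x - (numq r)%:~R|.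
  apply: lt_le_trans (gap_gt0 C g0 b) _; apply: (best_approximation C) => //.
  by rewrite b0 (leq_trans _ (den_ge C _)).
have -> : b%:R * x = (numq r)%:~R; last by rewrite subrr normr0 ltxx.
have -> : b%:R = (denq r)%:~R :> R by rewrite -[in RHS]absz_denq.
rewrite -rx -{2}(divq_num_den r) fmorph_div /= !ratr_int mulrC divfK//.
by rewrite intr_eq0 denq_eq0.
Qed.

Lemma dist_int_den_le (R : realType) a p q (x : R) : convergents a p q ->
  (forall n, 0 <= gap p q x n) ->
  forall n, dist_int ((q n)%:R * x) <= (q n.+1)%:R^-1.
Proof.
move=> C g0 n; apply: le_trans (gap_ub C g0 n).
have [_ /(_ (p n)%:Z)/le_trans] := dist_int_min ((q n)%:R * x); apply.
rewrite -[leRHS]ger0_norm// /gap normrM normrX normrN1 expr1n mul1r.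
by rewrite lexx.
Qed.

Lemma dist_int_ge_den (R : realType) a p q (x : R) : convergents a p q ->
  (forall n, 0 <= gap p q x n) -> forall n (k : nat), (0 < k < q n.+2)%N ->
  (2 * (q n.+2)%:R)^-1 <= dist_int (k%:R * x).
Proof.
move=> C g0 n k kq; have [[m ->] _] := dist_int_min (k%:R * x).
by apply: le_trans (gap_lb C g0 n) _; apply: (best_approximation C).
Qed.

Lemma den_bracket a p q : convergents a p q -> forall k, (0 < k)%N ->
  exists n, (q n.+1 <= k < q n.+2)%N.
Proof.
move=> C k k0.
have ex : exists n, (k < q n.+1)%N by exists k; exact: den_ge C _.
case: (ex_minnP ex) => -[|n] kn nmin; first by move: kn; rewrite (den1 C); lia.
exists n; rewrite kn andbT leqNgt; apply/negP => /nmin; lia.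
Qed.

(** * Prescribing the type *)

(** Adding 1 to the integer part keeps the digit positive and at least
    [k ^ s n], at the cost of a factor at most 2 when [k ^ s n >= 1]. *)
Definition digit (R : realType) (s : nat -> R) n (k : nat) : nat :=
  (Num.truncn (k%:R `^ s n)).+1.

(** From [q_{n+2} = a_n q_{n+1} + q_n]: the digit is at least
    [q_{n+1}^{s_n}], at most twice that, and [q_n <= q_{n+1}]. *)
Lemma digit_growth (R : realType) (s : nat -> R) p q :
  (forall n, 0 <= s n) ->
  convergents (fun n => digit s n (q n.+1)) p q -> forall n,
  (q n.+1)%:R `^ (1 + s n) <= (q n.+2)%:R <= 3 * (q n.+1)%:R `^ (1 + s n).
Proof.
move=> s0 C n; have q0 m : 0 < (q m)%:R :> R by rewrite ltr0n (den_gt0 C).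
have q1 m : 1 <= (q m)%:R :> R by rewrite ler1n (den_gt0 C).
rewrite powRD; last by apply/implyP => _; rewrite gt_eqF.
rewrite powRr1 ?ler0n//.
have x1 : 1 <= (q n.+1)%:R `^ s n.
  by rewrite -[leLHS](powRr0 (q n.+1)%:R); apply: ler_powR.
have := truncnS_gt ((q n.+1)%:R `^ s n).
have : (Num.truncn ((q n.+1)%:R `^ s n))%:R <= (q n.+1)%:R `^ s n.
  by rewrite truncn_le powR_ge0.
have : (q n)%:R <= (q n.+1)%:R :> R.
  rewrite ler_nat; case: (n) => [|m]; first by rewrite (den0 C) (den1 C).
  exact/ltnW/(den_ltS C).
rewrite (denSS C) /digit natrD natrM -natr1.
set T := (Num.truncn _)%:R; move: x1 (q0 n) (q0 n.+1).
set X := _ `^ _; set Q := (q n)%:R; set Q' := (q n.+1)%:R.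
move=> X1 Q0 Q'0 QQ' TX XT; apply/andP; split; nra.
Qed.

(** The denominators themselves are good: once [n >= m],
    [q_{n+1}^theta / q_{n+2} <= q_{n+1}^{- c}]. *)
Lemma approximable_digit (R : realType) (s : nat -> R) p q x theta c m :
  (forall n, 0 <= s n) ->
  convergents (fun n => digit s n (q n.+1)) p q ->
  (forall n, 0 <= gap p q x n) ->
  0 < c -> (forall n, (m <= n)%N -> theta + c <= 1 + s n) ->
  approximable x theta.
Proof.
move=> s0 C g0 c0 sge eps N eps0.
have [M Mlt] := powRN_small c0 eps0.
pose n := maxn m (maxn M N).
have qn : (n <= q n.+1)%N by apply: leq_trans (den_ge C _).
exists (q n.+1); first by apply: leq_trans qn; rewrite !leq_max leqnn !orbT.
apply: le_lt_trans (Mlt (q n.+1) _); last first.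
  by apply: leq_trans qn; rewrite !leq_max leqnn !orbT.
have q0 : 0 < (q n.+1)%:R :> R by rewrite ltr0n (den_gt0 C).
have q1 : 1 <= (q n.+1)%:R :> R by rewrite ler1n (den_gt0 C).
have /andP[grow _] := digit_growth s0 C n.
apply: (@le_trans _ _ ((q n.+1)%:R `^ theta * ((q n.+1)%:R `^ (1 + s n))^-1)).
  rewrite ler_pM2l ?powR_gt0//; apply: le_trans (dist_int_den_le C g0 n.+1) _.
  by rewrite lef_pV2 ?posrE ?powR_gt0// (lt_le_trans _ grow) ?powR_gt0.
rewrite -powRN -powRD; last by apply/implyP => _; rewrite gt_eqF.
apply: ler_powR => //; have := sge n; rewrite leq_maxl => /(_ isT); lra.
Qed.

(** For [q_{n+1} <= k < q_{n+2}], [best_approximation] gives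
    [k^theta ||k x|| >= q_{n+1}^theta / (2 q_{n+2})], while
    [q_{n+2} <= 3 q_{n+1}^theta]. *)
Lemma not_approximable_digit (R : realType) (s : nat -> R) p q x theta :
  (forall n, 0 <= s n) ->
  convergents (fun n => digit s n (q n.+1)) p q ->
  (forall n, 0 <= gap p q x n) ->
  (forall n, 1 + s n <= theta) -> ~ approximable x theta.
Proof.
move=> s0 C g0 sle app.
have [k k0] := app 6^-1 1%N ltac:(by rewrite invr_gt0).
have [n /andP[nk kn]] := den_bracket C k0.
apply/negP; rewrite -leNgt.
have q0 m : 0 < (q m)%:R :> R by rewrite ltr0n (den_gt0 C).
have q1 : 1 <= (q n.+1)%:R :> R by rewrite ler1n (den_gt0 C).
have theta0 : 0 <= theta by have := sle 0%N; have := s0 0%N; lra.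
have /andP[_ grow] := digit_growth s0 C n.
set Y := (q n.+1)%:R `^ (1 + s n) in grow.
have Y0 : 0 < Y by rewrite powR_gt0.
have kY : Y <= k%:R `^ theta.
  apply: (@le_trans _ _ ((q n.+1)%:R `^ theta)); first exact: ler_powR.
  by apply: ge0_ler_powR => //; rewrite ?nnegrE ?ler_nat.
have dist : (6 * Y)^-1 <= dist_int (k%:R * x).
  apply: le_trans (dist_int_ge_den C g0 (n := n) _); last by rewrite k0.
  by rewrite lef_pV2 ?posrE ?mulr_gt0//; lra.
apply: (@le_trans _ _ (Y * (6 * Y)^-1)).
  by rewrite invfM mulrCA mulfV ?mulr1// gt_eqF.
by apply: ler_pM => //; rewrite ?invr_ge0 ?mulr_ge0// ltW.
Qed.

Lemma irr_type_exists (R : realType) (t : \bar R) : (1 <= t)%E ->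
  exists x : @irrational R, irr_type x = t.
Proof.
move=> t1; pose s n : R := if t is t'%:E then t' - 1 else n%:R.
have s0 n : 0 <= s n.
  by rewrite /s; case: t t1 {s} => [t'||] //; rewrite lee_fin subr_ge0.
have [p [q C]] := convergents_exist (a := digit s) (fun _ _ => isT).
have [x g0] := convergents_limit R C.
have irr : irrational x := gap_irrational C g0.
exists (SigSub (mem_set irr)); apply/eqP; rewrite eq_le; apply/andP; split.
  apply: irr_type_le => theta tt; apply: (not_approximable_digit s0 C g0) => n.
  move: t1 tt; rewrite /s /=; case: (t) => [t'||] //=.
  by rewrite !lte_fin => _ /ltW; rewrite addrC subrK.
apply: irr_type_ge => theta tt.
(* The slack is the constant [t - theta] for finite [t]; for [t = +oo] the
   exponents [s n = n] are unbounded and slack 1 is eventually available. *)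
have [m hm] : exists m, forall n, (m <= n)%N ->
    theta + (if t is t'%:E then t' - theta else 1) <= 1 + s n.
  move: t1 tt; rewrite /s /=; case: (t) => [t'||] //=.
    by move=> _ _; exists 0%N => n _; lra.
  move=> _ _; exists (Num.truncn theta).+1 => n mn.
  rewrite addrC lerD2l; apply: le_trans (ltW (truncnS_gt _)) _.
  by rewrite ler_nat.
apply: (approximable_digit s0 C g0 _ hm).
by move: t1 tt; case: (t) => [t'||] //=; rewrite lte_fin subr_gt0.
Qed.

Unset Implicit Arguments.

(** * Surjectivity and density of the level sets *)

Theorem theorem1p2 (R : realType) :
  [/\ set_fun [set: @irrational R] `[1%E, +oo%E] (@irr_type R),
      set_surj [set: @irrational R] `[1%E, +oo%E] (@irr_type R)
    & forall t : \bar R, t \in `[1%E, +oo%E] ->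
        dense [set alpha : @irrational R | irr_type alpha = t]].
Proof.
split=> [x _ /=|t /=|t].
- rewrite in_itv /= leey andbT; apply: irr_type_ge => theta; rewrite lte_fin.
  by apply: approximable_lt1; exact: set_valP.
- rewrite in_itv /= leey andbT => /irr_type_exists[x <-].
  by exists x.
rewrite in_itv /= leey andbT => /irr_type_exists[x xt] O [y Oy] [V oV VO].
have Vy : V (\val y) by rewrite -VO in Oy.
have := open_nbhs_nbhs (conj oV Vy).
rewrite -nbhs_ballE => -[e /= e0 yeV].
(* A rational translate of [x] falls in the ball of radius [e] around [y]. *)
have [r] : exists r : rat,
    ratr r \in `](\val y - \val x - e), (\val y - \val x + e)[.
  by apply: rat_in_itvoo; lra.
rewrite in_itv /= => /andP[r1 r2].
have irr : irrational (\val x + ratr r) := irrationalD_rat (set_valP x).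
pose z : @irrational R := SigSub (mem_set irr).
exists z; split; last by rewrite /= -xt; exact: (@irr_typeD_rat _ x z r).
rewrite -VO /=; apply: yeV; rewrite /ball /=.
change (`|\val y - (\val x + ratr r)| < e); rewrite ltr_norml /=.
by apply/andP; split; lra.
Qed.
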